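(* Let $\Theta\subset\mathbb{R}^p$ and $\Lambda\subset\mathbb{R}^q$ be open and let $F:\Theta\times\Lambda\to\mathbb{R}^{K+1}$ be the joint weak feature map $$F(\theta,\lambda)=\bigl(\langle T_\theta,x^{j_0}\varphi_\lambda(x)\rangle,\ldots,\langle T_\theta,x^{j_K}\varphi_\lambda(x)\rangle\bigr).$$ Let $D\subset\mathbb{R}^{K+1}$ be a smooth submanifold of codimension $c$, let $(\theta,\lambda)\in\Theta\times\Lambda$ be such that $y=F(\theta,\lambda)\in D$, let $N_yD=(T_yD)^\perp$ be the normal space to $D$ at $y$ in $\mathbb{R}^{K+1}$, and let $\pi_N:\mathbb{R}^{K+1}\to N_yD$ denote the orthogonal projection. Write $DF(\theta,\lambda)=(D_\theta F,\;D_\lambda F)$, where $D_\theta F$ and $D_\lambda F$ are the partial derivatives of $F$ at $(\theta,\lambda)$ with respect to $\theta$ and $\lambda$. Then $F$ is transversal to $D$ at $(\theta,\lambda)$ if and only if $$\pi_N\bigl(\operatorname{Im}D_\theta F\bigr)+\pi_N\bigl(\operatorname{Im}D_\lambda F\bigr)=N_yD.$$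
   Context: Here $\{T_\theta:\theta\in\Theta\}\subset\mathcal{S}'(\mathbb{R})$ is a family of tempered distributions, $\{\varphi_\lambda\}_{\lambda\in\Lambda}\subset\mathcal{S}(\mathbb{R})$ is a family of positive Schwartz functions (kernels), $0\le j_0<\cdots<j_K$ are fixed integers, and the joint map $F$ is of class $C^r$ with $r\ge1$. For $F(\theta,\lambda)=y\in D$, transversality of $F$ to $D$ at $(\theta,\lambda)$ means $\operatorname{Im}DF(\theta,\lambda)+T_yD=\mathbb{R}^{K+1}$. *)

(* Defs.v *)
From HB Require Import structures.
From mathcomp Require Import all_boot all_order all_algebra.
From mathcomp Require Import all_classical all_reals all_analysis.

Set Implicit Arguments.
Unset Strict Implicit.
Unset Printing Implicit Defensive.

Import Order.TTheory GRing.Theory Num.Theory.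
Import numFieldNormedType.Exports.

Local Open Scope ring_scope.
Local Open Scope classical_set_scope.

Section Schwartz.
Context {R : realType}.
Implicit Types f g : R -> R.

Definition is_schwartz f : Prop :=
  (forall n x, derivable (f^`(n)%classic) x 1) /\
  (forall m n, exists C : R, forall x, `|x ^+ m * f^`(n)%classic x| <= C).

Definition schwartz_pred : {pred R -> R} := mem [set f | is_schwartz f].

Lemma schwartz_predP f : reflect (is_schwartz f) (f \in schwartz_pred).
Proof. by apply: (iffP idP); rewrite inE. Qed.

Lemma derive1n_lin (a : R) f g n :
  (forall n x, derivable (f^`(n)%classic) x 1) ->
  (forall n x, derivable (g^`(n)%classic) x 1) ->
  (a *: f + g)^`(n)%classic = a *: f^`(n)%classic + g^`(n)%classic.
Proof.
move=> df dg; elim: n => [//|n IH]; rewrite !derive1nS IH.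
apply/funext => x; rewrite !derive1E deriveD//; last exact: derivableZ.
by rewrite deriveZ// -!derive1E.
Qed.

Lemma derive1n_mulX f n :
  (forall n x, derivable (f^`(n)%classic) x 1) ->
  (id * f)^`(n)%classic = id * f^`(n)%classic + n%:R *: f^`(n.-1)%classic.
Proof.
move=> df; elim: n => [|n IH]; first by rewrite scale0r addr0.
rewrite !derive1nS IH; apply/funext => x.
rewrite derive1E deriveD; [|exact: derivableM|exact: derivableZ].
rewrite deriveM// deriveZ// derive_id -!derive1E.
case: n {IH} => [|n] /=.
  rewrite !fctE/= scale0r addr0 scale1r; congr (_ + _).
  by rewrite /GRing.scale/= mulr1.
rewrite !fctE/= -!derive1nS -addrA; congr (_ + _).
by rewrite [in RHS]mulrS scalerDl scale1r; congr (_ + _);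
  rewrite /GRing.scale/= mulr1.
Qed.

Lemma schwartz_submod_closed : submod_closed schwartz_pred.
Proof.
split.
  apply/schwartz_predP; have d0 n : (0 : R -> R)^`(n)%classic = 0.
    elim: n => [//|n IH]; rewrite derive1nS IH; apply/funext => x.
    exact: derive1_cst.
  split=> [n x|m n]; first by rewrite d0; exact: derivable_cst.
  by exists 0 => x; rewrite d0 mulr0 normr0.
move=> a f g /schwartz_predP[df bf] /schwartz_predP[dg bg].
apply/schwartz_predP; split=> [n x|m n].
  by rewrite derive1n_lin//; apply: derivableD => //; exact: derivableZ.
have [Cf hf] := bf m n; have [Cg hg] := bg m n.
exists (`|a| * Cf + Cg) => x; rewrite derive1n_lin// !fctE mulrDr.
rewrite (le_trans (ler_normD _ _))// lerD//.
by rewrite /GRing.scale/= mulrCA normrM ler_wpM2l.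
Qed.

Lemma schwartz_mulX f : f \in schwartz_pred -> id * f \in schwartz_pred.
Proof.
move=> /schwartz_predP[df bf]; apply/schwartz_predP; split=> [n x|m n].
  rewrite derive1n_mulX//; apply: derivableD; last exact: derivableZ.
  exact: derivableM.
have [C1 h1] := bf m.+1 n; have [C2 h2] := bf m n.-1.
exists (C1 + n%:R * C2) => x; rewrite derive1n_mulX// !fctE mulrDr.
rewrite (le_trans (ler_normD _ _))// lerD//; first by rewrite mulrA -exprSr.
by rewrite /GRing.scale/= mulrCA normrM normr_nat ler_wpM2l.
Qed.

Lemma schwartz_mulXn j f :
  f \in schwartz_pred -> (fun x => x ^+ j * f x) \in schwartz_pred.
Proof.
move=> Sf; elim: j => [|j IH].
  by rewrite (_ : (fun _ => _) = f)//; apply/funext => x; rewrite mul1r.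
rewrite (_ : (fun _ => _) = id * (fun x => x ^+ j * f x)); first exact: schwartz_mulX.
by apply/funext => x; rewrite !fctE/= exprS mulrA.
Qed.

End Schwartz.

Arguments schwartz_pred : clear implicits.

HB.instance Definition _ (R : realType) :=
  GRing.isSubmodClosed.Build R (R -> R) (schwartz_pred R)
    schwartz_submod_closed.

Record schwartz (R : realType) := Schwartz {
  schwartz_fun :> R -> R ;
  schwartz_funP : schwartz_fun \in schwartz_pred R }.

HB.instance Definition _ (R : realType) := [isSub for @schwartz_fun R].
HB.instance Definition _ (R : realType) := [Choice of schwartz R by <:].
HB.instance Definition _ (R : realType) :=
  [SubChoice_isSubLmodule of schwartz R by <:].

Definition schwartz_mulpow (R : realType) (j : nat) (f : schwartz R)
    : schwartz R :=
  Schwartz (schwartz_mulXn j (schwartz_funP f)).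

Definition schwartz_seminorm (R : realType) (m n : nat) (f : schwartz R) : R :=
  sup (range (fun x : R => `|x ^+ m * f^`(n)%classic x|)).

(* Continuity for the locally convex topology generated by the seminorms. *)
Definition schwartz_continuous (R : realType) (T : schwartz R -> R) : Prop :=
  forall (f : schwartz R) (e : R), 0 < e ->
    exists (N : nat) (d : R), 0 < d /\
      forall g : schwartz R,
        (forall m n, (m <= N)%N -> (n <= N)%N ->
           schwartz_seminorm m n (g - f) < d) ->
        `|T g - T f| < e.

(* Schwartz functions and distributions are real-valued, so that pairings are
   real numbers. *)
Record tempered_distribution (R : realType) := TemperedDistribution {
  distr_fun :> {scalar schwartz R} ;
  distr_continuous : schwartz_continuous distr_fun }.

Definition weak_feature_map (R : realType) (p q K : nat) (j : 'I_K.+1 -> nat)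
    (T : 'rV[R]_p -> tempered_distribution R) (phi : 'rV[R]_q -> schwartz R)
    (z : 'rV[R]_p * 'rV[R]_q) : 'rV[R]_K.+1 :=
  \row_i T z.1 (schwartz_mulpow (j i) (phi z.2)).

(* f is of class C^k on U. For U open and V finite dimensional this is the usual
   notion: all partial derivatives of order at most k exist and are continuous
   on U. *)
Fixpoint class_C (R : realType) (V W : normedModType R) (k : nat) (U : set V)
    (f : V -> W) : Prop :=
  match k with
  | 0 => forall x, U x -> {for x, continuous f}
  | k'.+1 => (forall x, U x -> differentiable f x) /\
             (forall v : V, class_C k' U ('D_v f))
  end.

Definition smooth_on (R : realType) (V W : normedModType R) (U : set V)
    (f : V -> W) : Prop :=
  forall k, class_C k U f.

(* Embedded submanifold of codimension c: near each of its points, some smooth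
   diffeomorphism f : U -> V with inverse g straightens D to the vanishing of
   the last c coordinates. *)
Definition smooth_submanifold (R : realType) (n c : nat) (D : set 'rV[R]_n)
    : Prop :=
  (c <= n)%N /\
  forall y, D y ->
    exists (U V : set 'rV[R]_n) (f g : 'rV[R]_n -> 'rV[R]_n),
      [/\ [/\ open U, open V & U y],
          [/\ smooth_on U f & smooth_on V g],
          [/\ forall x, U x -> V (f x) & forall z, V z -> U (g z)],
          [/\ {in U, cancel f g} & {in V, cancel g f}] &
          forall x, U x ->
            (D x <-> forall i : 'I_n, (n - c <= i)%N -> f x 0 i = 0)].

(* Velocities at y of the smooth curves drawn on D. *)
Definition tangent_space_at (R : realType) (n : nat) (D : set 'rV[R]_n)
    (y : 'rV[R]_n) : set 'rV[R]_n :=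
  [set v | exists (e : R) (gam : R -> 'rV[R]_n),
     [/\ 0 < e, smooth_on (ball (0 : R) e) gam,
         forall t, ball (0 : R) e t -> D (gam t),
         gam 0 = y & gam^`()%classic 0 = v]].

Definition dotmul (R : realType) (n : nat) (u v : 'rV[R]_n) : R :=
  (u *m v^T) 0 0.

Definition orth_compl (R : realType) (n : nat) (A : set 'rV[R]_n)
    : set 'rV[R]_n :=
  [set u | forall v, A v -> dotmul u v = 0].

Definition normal_space_at (R : realType) (n : nat) (D : set 'rV[R]_n)
    (y : 'rV[R]_n) : set 'rV[R]_n :=
  orth_compl (tangent_space_at D y).

(* The point u of N such that x - u is orthogonal to N; it exists and is unique
   when N is a linear subspace. *)
Definition orth_proj (R : realType) (n : nat) (N : set 'rV[R]_n)
    (x : 'rV[R]_n) : 'rV[R]_n :=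
  get [set u | N u /\ orth_compl N (x - u)].

Definition set_sum (R : realType) (n : nat) (A B : set 'rV[R]_n)
    : set 'rV[R]_n :=
  [set a + b | a in A & b in B].

Definition transversal_at (R : realType) (V : normedModType R) (n : nat)
    (F : V -> 'rV[R]_n) (D : set 'rV[R]_n) (z : V) : Prop :=
  set_sum (range ('d F z)) (tangent_space_at D (F z)) = setT.

(* Main.v *)
Require Import Defs.
From HB Require Import structures.
From mathcomp Require Import all_boot all_order all_algebra.
From mathcomp Require Import all_classical all_reals all_analysis.

Set Implicit Arguments.
Unset Strict Implicit.
Unset Printing Implicit Defensive.

Import Order.TTheory GRing.Theory Num.Theory.
Import numFieldNormedType.Exports.

Local Open Scope ring_scope.
Local Open Scope classical_set_scope.

(** Everything reduces to linear algebra in [R^(K+1)] once the tangent space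
    [T] of [D] at [y] is known to be a linear subspace. This has to be proved,
    because [T] is a set of velocities of curves: in a straightening chart [f]
    it is the kernel of the last [c] coordinates of the differential of [f] at
    [y] ([tangent_space_ker]).

    For a subspace [T] of a Euclidean space and [N = T^perp], every vector [x]
    is the sum of a vector of [T] and of its projection on [N]
    ([ker_orth_decomp], [orth_projE]). Two vectors with the same projection
    therefore differ by an element of [T], so that a set [W] satisfies
    [W + T = R^(K+1)] exactly when its projection is all of [N]; the projection
    being additive, this applies to [W = W1 + W2] ([spanning_mod_proj]).

    Here [W1] and [W2] are the images of the two partial derivatives, and their
    sum is the image of the total derivative because
    [DF(u, v) = D_theta F u + D_lambda F v] ([diff_partials]). *)

(** * Orthogonal projection and spanning modulo a subspace *)

Lemma dotmulE (R : realType) (n : nat) (u v : 'rV[R]_n) :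
  dotmul u v = \sum_i u 0 i * v 0 i.
Proof. by rewrite /dotmul mxE; apply: eq_bigr => i _; rewrite mxE. Qed.

Lemma dotmulC (R : realType) (n : nat) (u v : 'rV[R]_n) :
  dotmul u v = dotmul v u.
Proof. by rewrite !dotmulE; apply: eq_bigr => i _; rewrite mulrC. Qed.

Lemma dotmulDl (R : realType) (n : nat) (u v w : 'rV[R]_n) :
  dotmul (u + v) w = dotmul u w + dotmul v w.
Proof. by rewrite /dotmul mulmxDl mxE. Qed.

Lemma dotmulBl (R : realType) (n : nat) (u v w : 'rV[R]_n) :
  dotmul (u - v) w = dotmul u w - dotmul v w.
Proof. by rewrite /dotmul mulmxBl !mxE. Qed.

Lemma dotmul_eq0 (R : realType) (n : nat) (u : 'rV[R]_n) :
  dotmul u u = 0 -> u = 0.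
Proof.
rewrite dotmulE => /eqP; rewrite psumr_eq0 => [/allP u0|i _]; last first.
  by rewrite -expr2 sqr_ge0.
apply/rowP => i; rewrite mxE; apply/eqP.
by have := u0 i (mem_index_enum i); rewrite -expr2 sqrf_eq0.
Qed.

Lemma orth_complD (R : realType) (n : nat) (A : set 'rV[R]_n) u v :
  orth_compl A u -> orth_compl A v -> orth_compl A (u + v).
Proof. by move=> uA vA w Aw; rewrite dotmulDl uA// vA// addr0. Qed.

Lemma orth_complB (R : realType) (n : nat) (A : set 'rV[R]_n) u v :
  orth_compl A u -> orth_compl A v -> orth_compl A (u - v).
Proof. by move=> uA vA w Aw; rewrite dotmulBl uA// vA// subr0. Qed.

(** Any candidate [w] for the projection differs from [u] by a vector which lies
    in the orthogonal complement of [A] and is orthogonal to it, hence is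
    null. *)
Lemma orth_projE (R : realType) (n : nat) (A : set 'rV[R]_n) t u :
  A t -> orth_compl A u -> orth_proj (orth_compl A) (t + u) = u.
Proof.
move=> At uA; rewrite /orth_proj; apply: get_unique => [|w [wA twA]].
  by split=> // v vA; rewrite addrK dotmulC vA.
apply/eqP; rewrite -subr_eq0; apply/eqP/dotmul_eq0.
have uwA : orth_compl A (w - u) by exact: orth_complB.
have {1}-> : w - u = t - (t + u - w) by rewrite -addrA opprD addNKr opprB.
by rewrite dotmulBl [dotmul t _]dotmulC uwA// twA// subrr.
Qed.

(** The rows of [A^T] are orthogonal to the kernel of [A], and rank-nullity
    leaves no room for anything else. *)
Lemma ker_orth_decomp (R : realType) (n m : nat) (A : 'M[R]_(n, m))
    (x : 'rV[R]_n) :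
  let T := [set v : 'rV[R]_n | v *m A = 0] in
  exists t u, [/\ T t, orth_compl T u & x = t + u].
Proof.
move=> T.
have orthA (w : 'rV[R]_m) : orth_compl T (w *m A^T).
  by move=> v Tv; rewrite /dotmul -mulmxA -trmx_mul Tv trmx0 mulmx0 mxE.
have cap0 : (kermx A :&: A^T = 0)%MS.
  apply/eqP/rowV0P => v; rewrite sub_capmx => /andP[/sub_kermxP vA].
  by move=> /submxP[w vw]; apply: dotmul_eq0; rewrite {1}vw orthA.
have full : row_full (kermx A + A^T)%MS.
  rewrite -col_leq_rank mxrank_disjoint_sum// mxrank_ker mxrank_tr.
  by rewrite subnK// rank_leq_row.
have /sub_addsmxP[[a b] /= ->] := submx_full x full.
exists (a *m kermx A), (b *m A^T); split=> //.
by rewrite /T/= -mulmxA mulmx_ker mulmx0.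
Qed.

(** Modulo [T], a vector is its projection on the orthogonal complement of [T]:
    summing up with [T] and projecting carry the same information. *)
Lemma spanning_mod_proj (R : realType) (n m : nat) (A : 'M[R]_(n, m))
    (W1 W2 : set 'rV[R]_n) :
  let T := [set v : 'rV[R]_n | v *m A = 0] in
  let N := orth_compl T in
  set_sum (set_sum W1 W2) T = setT <->
  set_sum (orth_proj N @` W1) (orth_proj N @` W2) = N.
Proof.
move=> T N; have dec x : exists2 t, T t &
    N (orth_proj N x) /\ x = t + orth_proj N x.
  have [t [u [Tt Nu ->]]] := ker_orth_decomp A x.
  by exists t; rewrite // orth_projE.
split=> [WT|WN]; apply/seteqP; split=> // x.
- move=> [_ [a _ <-] [_ [b _ <-] <-]].
  by have [_ _ [Na _]] := dec a; have [_ _ [Nb _]] := dec b; exact: orth_complD.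
- move=> Nx; have : setT x by []; rewrite -WT.
  move=> [_ [a Wa [b Wb <-]] [t Tt xE]].
  exists (orth_proj N a); first by exists a.
  exists (orth_proj N b); first by exists b.
  have [ta Tta [Na aE]] := dec a; have [tb Ttb [Nb bE]] := dec b.
  (* [x] is its own projection; it also differs from [pi_N a + pi_N b], which
     lies in [N], by an element of [T]. *)
  have Tsum : T (ta + tb + t) by rewrite /T/= !mulmxDl Tta Ttb Tt !addr0.
  have xsum : x = (ta + tb + t) + (orth_proj N a + orth_proj N b).
    by rewrite -xE {1}aE {1}bE addrACA [LHS]addrAC.
  have <- : orth_proj N x = x.
    by rewrite -{1}[x]add0r orth_projE// /T/= mul0mx.
  by rewrite xsum orth_projE//; exact: orth_complD.
- move=> _; have [t Tt [Nx xE]] := dec x.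
  move: (Nx); rewrite -{1}WN => -[_ [a Wa <-] [_ [b Wb <-] abE]].
  have [ta Tta [_ aE]] := dec a; have [tb Ttb [_ bE]] := dec b.
  exists (a + b); first by exists a => //; exists b.
  exists (t - (ta + tb)).
    by rewrite /T/= mulmxBl mulmxDl Tt Tta Ttb addr0 subr0.
  rewrite xE -abE {1}aE {1}bE [X in X + _]addrACA.
  by rewrite [LHS]addrC [LHS]addrA subrK.
Qed.

(** * Locality of the class C^k and restriction to lines *)

Lemma near_eq_differentiable (R : realType) (V W : normedModType R)
    (f g : V -> W) (x : V) :
  {near x, f =1 g} -> differentiable f x -> differentiable g x.
Proof.
(* ['d g x] is only determined once a linear first order expansion of [g] is
   available: the one of [f] serves, as the remainders agree near [x]. *)
move=> fg df; have gE : g \o shift x = cst (g x) + 'd f x +o_ 0 id.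
  apply/eqaddoP => e e0.
  have fg0 : \forall y \near (0 : V), f (y + x) = g (y + x).
    by move: fg; rewrite (near_shift 0)/=; apply: filterS => y; rewrite subr0.
  have /diff_locally/eqaddoP/(_ e e0) := df.
  apply: filterS2 fg0 => y fgy.
  by rewrite !fctE/= fgy (nbhs_singleton fg).
have [cdf _] := (diff_locallyP x f).1 df.
by apply/diff_locallyP; rewrite (diff_unique cdf gE).
Qed.

(** As [U] is open, [f] and [g] agree around each point of [U], so that their
    directional derivatives agree on all of [U] and the induction proceeds. *)
Lemma class_C_eq (R : realType) (V W : normedModType R) (k : nat) (U : set V)
    (f g : V -> W) :
  open U -> (forall x, U x -> f x = g x) -> class_C k U f -> class_C k U g.
Proof.
move=> oU; have nearU x : U x -> \forall y \near x, U y.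
  by move=> Ux; exact: open_nbhs_nbhs.
elim: k f g => [|k IH] f g fg /=.
  move=> cf x Ux; have fgx : {near x, f =1 g}.
    by apply: filterS (nearU x Ux) => y; exact: fg.
  rewrite /prop_for/continuous_at -fg//; apply: cvg_trans (cf x Ux).
  exact: near_eq_cvg.
move=> [df cf]; split=> [x Ux|v].
  by apply: near_eq_differentiable (df x Ux); apply: filterS (nearU x Ux).
apply: IH (cf v) => x Ux; apply: near_eq_derive.
by apply: filterS (nearU x Ux) => y; exact: fg.
Qed.

(** Deriving [t |-> s *: h (a + t *: w)] in a direction [v] gives a function of
    the same shape, with [h] replaced by its directional derivative along [w];
    the factor [s] absorbs the scalar [v] that comes out at each step. *)
Lemma class_C_line (R : realType) (V W : normedModType R) (k : nat)
    (I : set R) (U : set V) (h : V -> W) (a w : V) (s : R) :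
  open I -> (forall t, I t -> U (a + t *: w)) ->
  class_C k U h -> class_C k I (fun t : R => s *: h (a + t *: w)).
Proof.
move=> oI IU.
have dl t : is_diff t (fun t : R => a + t *: w) ( *:%R^~ w).
  by apply: is_diff_eq; rewrite add0r.
elim: k h s => [|k IH] h s /=.
  move=> ch t It; apply: cvgZl_tmp.
  apply: (@continuous_comp _ _ _ (fun t : R => a + t *: w) h) (ch _ (IU t It)).
  exact/differentiable_continuous.
move=> [dh ch].
have dhl t : I t -> is_diff t (fun t : R => s *: h (a + t *: w))
    (fun v => s *: 'd h (a + t *: w) (v *: w)).
  move=> It; have dht := differentiableP (dh _ (IU t It)).
  exact: (is_diffZ s (is_diff_comp (dl t) dht)).
split=> [t /dhl[]//|v].
apply: (class_C_eq oI _ (IH _ (s * v) (ch w))) => t It.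
have [dt dE] := dhl t It.
rewrite deriveE; last exact/dh/IU.
by rewrite deriveE// dE linearZ/= scalerA.
Qed.

(** * The tangent space of a submanifold is a linear subspace *)

(** In a chart [f] straightening [D], the curves drawn on [D] through [y] become
    curves on which the last [c] coordinates vanish, and straight lines pulled
    back by the inverse chart realise every such velocity. *)
Lemma tangent_space_ker (R : realType) (n c : nat) (D : set 'rV[R]_n)
    (y : 'rV[R]_n) :
  smooth_submanifold c D -> D y ->
  exists A : 'M[R]_n, tangent_space_at D y = [set v | v *m A = 0].
Proof.
move=> [_ charts] Dy.
have [U [V [f [g [[oU oV Uy] [sf sg] [UV VU] [fK gK] DE]]]]] := charts y Dy.
have nearU x : U x -> \forall z \near x, U z.
  by move=> Ux; exact: open_nbhs_nbhs.
have dfU x : U x -> differentiable f x by have [+ _] := sf 1%N; exact.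
have dgV z : V z -> differentiable g z by have [+ _] := sg 1%N; exact.
(* The Jacobian with its first [n - c] columns cleared: [v *m A] keeps just the
   coordinates of ['d f y v] that vanish for [v] tangent to [D]. *)
exists (\matrix_(i, j) if (n - c <= j)%N then lin1_mx ('d f y) i j else 0).
set A := \matrix_(_, _) _.
have kerA (v : 'rV[R]_n) :
    v *m A = 0 <-> forall i : 'I_n, (n - c <= i)%N -> ('d f y v) 0 i = 0.
  have vA i : (v *m A) 0 i = if (n - c <= i)%N then ('d f y v) 0 i else 0.
    rewrite -mul_rV_lin1 !mxE; case: ifP => ci.
      by apply: eq_bigr => k _; rewrite [A _ _]mxE ci.
    by rewrite big1// => k _; rewrite [A _ _]mxE ci mulr0.
  split=> [v0 i ci|v0]; first by have := vA i; rewrite v0 mxE ci.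
  by apply/rowP => i; rewrite vA mxE; case: ifP => // /v0.
apply/seteqP; split=> v; rewrite /= kerA.
  move=> [e [gam [e0 sgam Dgam gam0 gam'0]]] i ci.
  have dgam : differentiable gam 0.
    by have [+ _] := sgam 1%N; apply; exact: ballxx.
  have dgE : 'd gam 0 1 = v by rewrite -derive1E'.
  have dfgam : differentiable (f \o gam) 0.
    by apply: differentiable_comp; rewrite ?gam0//; exact: dfU.
  have <- : 'D_1 (f \o gam) 0 = 'd f y v.
    rewrite deriveE// diff_comp ?gam0//=; [by rewrite dgE|exact: dfU].
  rewrite derive_mx; last exact: diff_derivable.
  rewrite mxE; transitivity ('D_1 (cst 0 : R -> R) (0 : R));
    last exact: derive_cst.
  apply: near_eq_derive.
  have Ugam : \forall t \near (0 : R), U (gam t).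
    apply: (differentiable_continuous dgam); rewrite gam0; exact: nearU.
  near=> t; have Ut : U (gam t) by near: t.
  apply: (DE _ Ut).1 => //; apply: Dgam; near: t; exact: nbhsx_ballx.
move=> v0; pose w := 'd f y v.
pose l (t : R) := f y + t *: w.
have dl t : is_diff t l ( *:%R^~ w).
  by apply: is_diff_eq; rewrite add0r.
have l0 : l 0 = f y by rewrite /l scale0r addr0.
have [e /= e0 leV] : exists2 e : R, 0 < e & forall t, ball 0 e t -> V (l t).
  have : \forall t \near (0 : R), V (l t).
    have lc : {for 0, continuous l} by apply/differentiable_continuous.
    apply: lc; rewrite l0; apply: open_nbhs_nbhs; split=> //; exact: UV.
  by move=> /nbhs_ballP[e e0 le]; exists e.
have fyV := UV y Uy.
have gfy : g (f y) = y by apply: fK; rewrite inE.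
exists e, (g \o l); split=> //.
- move=> k; have oe : open (ball (0 : R) e) by exact: ball_open.
  apply: (class_C_eq oe _ (class_C_line 1 oe leV (sg k))) => t _.
  by rewrite scale1r.
- move=> t /leV Vlt; apply/DE => [|i ci]; first exact: VU.
  by rewrite /= gK ?inE// !mxE v0// mulr0 addr0; exact: ((DE y Uy).1 Dy).
- by rewrite /= l0.
- have dgl : differentiable g (l 0) by rewrite l0; exact: dgV.
  rewrite derive1E'; last exact: differentiable_comp.
  rewrite diff_comp//= diff_val/= scale1r l0.
  have dgf : differentiable (g \o f) y.
    by apply: differentiable_comp; [exact: dfU|exact: dgV].
  (* [g \o f] is the identity near [y] only, which is enough for its derivative
     there. *)
  have idv : 'd (g \o f) y v = v.
    rewrite -deriveE// (@near_eq_derive _ _ _ _ id) ?derive_id//.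
    by apply: filterS (nearU y Uy) => x Ux; rewrite /= fK ?inE.
  have chain := congr1 (@^~ v) (diff_comp (dfU _ Uy) (dgV _ fyV)).
  exact: (etrans (esym chain) idv).
Unshelve. all: by end_near. Qed.

(** * Partial derivatives and transversality *)

(** The partial maps are [F] composed with the affine embeddings
    [t |-> (t, y)] and [t |-> (x, t)]. *)
Lemma diff_partials (R : realType) (U V W : normedModType R) (F : U * V -> W)
    (x : U) (y : V) :
  differentiable F (x, y) ->
  forall u v, 'd F (x, y) (u, v) =
              'd (fun t => F (t, y)) x u + 'd (fun t => F (x, t)) y v.
Proof.
move=> dF u v.
have dxy : 'd (fun t => F (t, y)) x u = 'd F (x, y) (u, 0).
  have ix : is_diff x (fun t : U => (t, y)) (fun t => (t, 0)).
    exact: is_diff_pair.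
  rewrite (_ : (fun t => _) = F \o (fun t => (t, y)))//.
  by rewrite diff_comp//= diff_val.
have dyx : 'd (fun t => F (x, t)) y v = 'd F (x, y) (0, v).
  have iy : is_diff y (fun t : V => (x, t)) (fun t => (0, t)).
    exact: is_diff_pair.
  rewrite (_ : (fun t => _) = F \o (fun t => (x, t)))//.
  by rewrite diff_comp//= diff_val.
by rewrite dxy dyx -linearD/=; congr ('d F _ (_, _)); rewrite ?addr0 ?add0r.
Qed.

Theorem lemma5p1 (R : realType) (p q K c r : nat)
    (Theta : set 'rV[R]_p) (Lambda : set 'rV[R]_q)
    (T : 'rV[R]_p -> tempered_distribution R)
    (phi : 'rV[R]_q -> schwartz R)
    (j : 'I_K.+1 -> nat)
    (D : set 'rV[R]_K.+1)
    (theta : 'rV[R]_p) (lambda : 'rV[R]_q) :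
  let F := weak_feature_map j T phi in
  open Theta -> open Lambda ->
  (forall l, Lambda l -> forall x, 0 < phi l x) ->
  (forall a b : 'I_K.+1, (a < b)%N -> (j a < j b)%N) ->
  (1 <= r)%N -> class_C r (Theta `*` Lambda) F ->
  smooth_submanifold c D ->
  Theta theta -> Lambda lambda -> D (F (theta, lambda)) ->
  let N := normal_space_at D (F (theta, lambda)) in
  let piN := orth_proj N in
  let DthetaF := 'd (fun t => F (t, lambda)) theta in
  let DlambdaF := 'd (fun l => F (theta, l)) lambda in
  transversal_at F D (theta, lambda) <->
  set_sum (piN @` range DthetaF) (piN @` range DlambdaF) = N.
Proof.
move=> F _ _ _ _ r1 CF sD Tht Lal DF N piN DthetaF DlambdaF.
have dF : differentiable F (theta, lambda).
  by case: r r1 CF => // r _ [+ _]; apply.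
have [A TE] := tangent_space_ker sD DF.
have spanE : range ('d F (theta, lambda)) =
    set_sum (range DthetaF) (range DlambdaF).
  apply/seteqP; split=> x.
    move=> [[u v] _ <-]; rewrite diff_partials//.
    by exists (DthetaF u) => //; exists (DlambdaF v).
  move=> [_ [u _ <-] [_ [v _ <-] <-]].
  by exists (u, v) => //; rewrite diff_partials.
rewrite /transversal_at spanE /piN /N /normal_space_at TE.
exact: spanning_mod_proj.
Qed.
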